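(* Let $g_1,\ldots,g_m:\{\pm1\}^n\to\mathbb{R}$ be functions on pairwise disjoint sets of input variables and let $\sigma_1,\ldots,\sigma_m$ be positive numbers such that for all $i\in[m]$: $\mathbb{E}[g_i]=0$, $L_1[g_i]\le t$, and $\mathbb{E}_{x\sim\{\pm1\}^n}[g_i(x)^{2k}]\le(2k)^{2k}\sigma_i^{2k}$ for all integers $k\ge1$. Let $\sigma^2=(\sum_i\sigma_i^2)/m$, let $\delta\in(0,1)$, and suppose $$m\sigma^2\le\frac{1}{\log(1/\delta)^{25}},\qquad k=\left\lceil\frac{5\log(1/\delta)}{\log(1/(m\sigma^2))}\right\rceil,\qquad \epsilon=\frac{\delta^4}{(mt+1)^{2k}}.$$ Let $P(x)=\sum_{i=0}^m c_iS_i(g_1(x),\ldots,g_m(x))$ be a function that takes values in $[-B,B]$ on $\{\pm1\}^n$, with $|c_i|\le C$ for all $i\in[m]$. Then: (1) for every $\epsilon$-biased distribution $\mathcal{D}$ on $\{\pm1\}^n$, $\left|\mathbb{E}_{x\sim\{\pm1\}^n}[P(x)]-\mathbb{E}_{x\sim\mathcal{D}}[P(x)]\right|\le O(B+C)\delta$; (2) $P$ has $O(B+C)\delta$-sandwiching approximations of $L_1$-norm $O\big((B+C)(mt+1)^{2k}\delta^{-3}\big)$. (Here $O(\cdot)$ hides absolute constants.)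
   Context: $S_k(z_1,\ldots,z_m)=\sum_{I\subseteq[m],|I|=k}\prod_{i\in I}z_i$ is the $k$-th elementary symmetric polynomial ($S_0=1$). Expectations without subscript are under the uniform distribution on $\{\pm1\}^n$. Every $h:\{\pm1\}^n\to\mathbb{R}$ has a unique expansion $h(x)=\sum_{I\subseteq[n]}c_I\prod_{i\in I}x_i$, and $L_1[h]=\sum_I|c_I|$. A distribution $\mathcal{D}$ on $\{\pm1\}^n$ is $\epsilon$-biased if $|\mathbb{E}_{x\sim\mathcal{D}}[\prod_{i\in I}x_i]|\le\epsilon$ for every nonempty $I\subseteq[n]$. A function $f:\{\pm1\}^n\to\mathbb{R}$ has $\delta$-sandwiching approximations of $L_1$-norm $t'$ if there exist $f_\ell,f_u:\{\pm1\}^n\to\mathbb{R}$ with $f_\ell(x)\le f(x)\le f_u(x)$ for all $x$, $\mathbb{E}[f_u]-\mathbb{E}[f_\ell]\le\delta$, and $L_1[f_\ell],L_1[f_u]\le t'$.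
   Formalization: The formal theorem requires k to be a nonnegative integer (for negative k, possible only when mσ² > 1 and δ > 1/2, claim (2) fails); at mσ² = 1, where the formula for k is undefined, k is taken to be 0; m ≥ 1 and log is base 2. *)

(* Defs.v *)
From HB Require Import structures.
From mathcomp Require Import all_boot all_order all_algebra.
From mathcomp Require Import boolp classical_sets reals exp.
Set Implicit Arguments.
Unset Strict Implicit.
Unset Printing Implicit Defensive.
Import Order.TTheory GRing.Theory Num.Theory.
Local Open Scope ring_scope.

(* {±1}^n is encoded by bit vectors: the bit b stands for the sign (-1)^b. *)
Definition cube (n : nat) := {ffun 'I_n -> bool}.

Definition coordinate (R : realType) (n : nat) (x : cube n) (i : 'I_n) : R :=
  (-1) ^+ (x i).

Definition chi (R : realType) (n : nat) (I : {set 'I_n}) (x : cube n) : R :=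
  \prod_(i in I) coordinate R x i.

Record distr (R : realType) (n : nat) := Distr {
  mass :> cube n -> R;
  mass_ge0 : forall x, 0 <= mass x;
  mass_sum1 : \sum_x mass x = 1
}.

Lemma uniform_ge0 (R : realType) (n : nat) (x : cube n) :
  0 <= (#|cube n|%:R : R)^-1.
Proof. by rewrite invr_ge0 ler0n. Qed.

Lemma card_cube (n : nat) : #|cube n| = (2 ^ n)%N.
Proof. by rewrite card_ffun card_bool card_ord. Qed.

Lemma card_cube_neq0 (R : realType) (n : nat) : (#|cube n|%:R : R) != 0.
Proof. by rewrite card_cube pnatr_eq0 expn_eq0. Qed.

Lemma uniform_sum1 (R : realType) (n : nat) :
  \sum_(x : cube n) (#|cube n|%:R : R)^-1 = 1.
Proof.
by rewrite sumr_const -[LHS]mulr_natr mulVf ?card_cube_neq0.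
Qed.

Definition uniform (R : realType) (n : nat) : distr R n :=
  Distr (@uniform_ge0 R n) (@uniform_sum1 R n).

Definition expect (R : realType) (n : nat) (D : distr R n) (h : cube n -> R) :
  R := \sum_x D x * h x.

Definition expectU (R : realType) (n : nat) (h : cube n -> R) : R :=
  expect (uniform R n) h.

Definition is_expansion (R : realType) (n : nat) (h : cube n -> R)
    (c : {ffun {set 'I_n} -> R}) : Prop :=
  forall x, h x = \sum_(I : {set 'I_n}) c I * chi R I x.

Lemma chiM (R : realType) (n : nat) (I : {set 'I_n}) (x y : cube n) :
  chi R I x * chi R I y = \prod_i (if i \in I then
    coordinate R x i * coordinate R y i else 1).
Proof. by rewrite /chi -big_split /= big_mkcond. Qed.

Lemma chi_dual_orthogonal (R : realType) (n : nat) (x y : cube n) :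
  \sum_(I : {set 'I_n}) chi R I x * chi R I y
    = if x == y then #|cube n|%:R else 0.
Proof.
under eq_bigr do rewrite chiM.
rewrite -(@bigA_distr R 0 1 *%R +%R _
  (fun i => coordinate R x i * coordinate R y i) (fun=> 1)).
have F i : coordinate R x i * coordinate R y i + 1
    = if x i == y i then 2 else 0.
  rewrite /coordinate; case: (x i) (y i) => [] [] /=;
  by rewrite ?expr0 ?expr1 ?mulrNN ?mulr1 ?mul1r ?addNr.
rewrite (eq_bigr _ (fun i _ => F i)).
case: eqP => [->|ne].
  under eq_bigr do rewrite eqxx.
  by rewrite prodr_const card_ord card_cube natrX.
have [i nei] : exists i, x i != y i.
  apply/existsP; rewrite -negb_forall; apply/negP => /forallP e.
  by apply: ne; apply/ffunP => i; exact/eqP.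
by rewrite (bigD1 i) //= (negbTE nei) mul0r.
Qed.

Lemma chi_orthogonal (R : realType) (n : nat) (I J : {set 'I_n}) :
  \sum_(x : cube n) chi R I x * chi R J x
    = if I == J then #|cube n|%:R else 0.
Proof.
pose F (i : 'I_n) (b : bool) : R :=
  (if i \in I then (-1) ^+ b else 1) * (if i \in J then (-1) ^+ b else 1).
transitivity (\sum_(x : cube n) \prod_i F i (x i)).
  apply: eq_bigr => x _; rewrite /chi.
  by rewrite [X in X * _]big_mkcond [X in _ * X]big_mkcond -big_split.
rewrite -(bigA_distr_bigA F).
have FE i : \sum_b F i b = if (i \in I) == (i \in J) then 2 else 0.
  rewrite big_bool /F; case: (i \in I) (i \in J) => [] [] /=;
  by rewrite ?expr0 ?expr1 ?mulrNN ?mulr1 ?mul1r ?addNr.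
rewrite (eq_bigr _ (fun i _ => FE i)).
case: eqP => [->|ne].
  under eq_bigr do rewrite eqxx.
  by rewrite prodr_const card_ord card_cube natrX.
have [i nei] : exists i, (i \in I) != (i \in J).
  apply/existsP; rewrite -negb_forall; apply/negP => /forallP e.
  by apply: ne; apply/setP => i; exact/eqP.
by rewrite (bigD1 i) //= (negbTE nei) mul0r.
Qed.

Lemma expansion_exists (R : realType) (n : nat) (h : cube n -> R) :
  exists c, is_expansion h c.
Proof.
exists [ffun I => expectU (fun x => h x * chi R I x)] => x.
under eq_bigr do rewrite ffunE /expectU /expect mulr_suml.
transitivity (\sum_y uniform R n y * h y
    * \sum_(I : {set 'I_n}) chi R I y * chi R I x); last first.
  rewrite [RHS]exchange_big /=; apply: eq_bigr => y _; rewrite mulr_sumr.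
  by apply: eq_bigr => I _; rewrite !mulrA.
rewrite (bigD1 x) //= chi_dual_orthogonal eqxx big1 => [|y neyx].
  by rewrite addr0 mulrAC mulVf ?mul1r // card_cube_neq0.
by rewrite chi_dual_orthogonal (negbTE neyx) mulr0.
Qed.

Lemma expansion_coefE (R : realType) (n : nat) (h : cube n -> R)
    (c : {ffun {set 'I_n} -> R}) : is_expansion h c ->
  forall I, c I = expectU (fun x => h x * chi R I x).
Proof.
move=> hc I; rewrite /expectU /expect.
transitivity (\sum_(J : {set 'I_n}) (#|cube n|%:R)^-1 * c J
    * \sum_x chi R J x * chi R I x).
  rewrite (bigD1 I) //= chi_orthogonal eqxx big1 => [|J neJI].
    by rewrite addr0 mulrAC mulVf ?mul1r // card_cube_neq0.
  by rewrite chi_orthogonal (negbTE neJI) mulr0.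
under eq_bigr do rewrite mulr_sumr.
rewrite exchange_big /=; apply: eq_bigr => x _.
rewrite hc mulr_suml mulr_sumr; apply: eq_bigr => J _.
by rewrite !mulrA.
Qed.

Lemma expansion_unique (R : realType) (n : nat) (h : cube n -> R)
    (c c' : {ffun {set 'I_n} -> R}) :
  is_expansion h c -> is_expansion h c' -> c = c'.
Proof.
by move=> hc hc'; apply/ffunP => I; rewrite (expansion_coefE hc)
  (expansion_coefE hc').
Qed.

Definition fourier (R : realType) (n : nat) (h : cube n -> R) :
  {ffun {set 'I_n} -> R} := projT1 (cid (expansion_exists h)).

Lemma fourierP (R : realType) (n : nat) (h : cube n -> R) :
  is_expansion h (fourier h).
Proof. exact: projT2 (cid (expansion_exists h)). Qed.

Definition L1norm (R : realType) (n : nat) (h : cube n -> R) : R :=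
  \sum_(I : {set 'I_n}) `|fourier h I|.

Definition elem_sym (R : realType) (m k : nat) (z : 'I_m -> R) : R :=
  \sum_(I : {set 'I_m} | #|I| == k) \prod_(i in I) z i.

Definition biased (R : realType) (n : nat) (eps : R) (D : distr R n) : Prop :=
  forall I : {set 'I_n}, I != finset.set0 -> `|expect D (chi R I)| <= eps.

Definition has_sandwiching (R : realType) (n : nat) (f : cube n -> R)
    (delta t' : R) : Prop :=
  exists fl fu : cube n -> R,
    [/\ forall x, fl x <= f x <= fu x,
        expectU fu - expectU fl <= delta,
        L1norm fl <= t' & L1norm fu <= t'].

Definition depends_only_on (R : realType) (n : nat) (V : {set 'I_n})
    (h : cube n -> R) : Prop :=
  forall x y : cube n, (forall j, j \in V -> x j = y j) -> h x = h y.

Definition log2 (R : realType) (x : R) : R := ln x / ln 2.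

(* Main.v *)
(* Write z = g(x), p1 = sum z_j, p2 = sum z_j^2 and M = max(|p1|, sqrt p2). All
   power sums of z are bounded by powers of M, so Newton's identities give
   |S_i(z)| <= M^i. Let Q be the truncation of P to the terms i < 2k. If
   M <= 1/2 the discarded terms form a geometric tail of size O(C M^(2k)); if
   M > 1/2 then P and Q are both O((B + C) (2M)^(2k)). Either way
   |P - Q| <= e := 2 (B + C) 4^k (p1^(2k) + p2^k), so Q - e and Q + e sandwich P.
   Jensen bounds the moment of p2, and symmetrization over a second copy of the
   cube followed by Khinchine reduces the moment of p1 to that of p2; the
   choice of k then makes the expectation of e at most O((B + C) delta). Part (1)
   follows from part (2). When delta > 1/4 (the only case where k may be 0) the
   constants -B and B are a sandwich. *)
Require Import Defs.
From mathcomp Require Import all_boot all_order all_algebra.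
From mathcomp Require Import reals.
From mathcomp Require Import exp ring lra zify.
Set Implicit Arguments.
Unset Strict Implicit.
Import Order.TTheory GRing.Theory Num.Theory.
Local Open Scope ring_scope.

(** * Power means and a Khinchine inequality *)

(** Convexity of the power function by induction: [x] times the tangent line for [k] exceeds the
    tangent line for [k.+1] by [k m^(k-1) (x - m)^2]. *)
Lemma power_tangent (R : realFieldType) (k : nat) (x m : R) :
  0 <= x -> 0 <= m -> m ^+ k + k%:R * m ^+ k.-1 * (x - m) <= x ^+ k.
Proof.
move=> x0 m0; elim: k => [|k IH]; first by rewrite !expr0 !mul0r addr0.
have H := ler_wpM2l x0 IH.
rewrite [leRHS]exprS; apply: le_trans H; rewrite /=.
case: k IH => [|k] _ /=; first by rewrite !expr0 expr1; lra.
have : 0 <= k.+1%:R * m ^+ k * (x - m) ^+ 2.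
  by rewrite mulr_ge0 ?sqr_ge0 // mulr_ge0 // exprn_ge0.
rewrite -subr_ge0 => h; rewrite -subr_ge0; apply: le_trans h _.
by rewrite le_eqVlt; apply/orP; left; apply/eqP; rewrite !exprS -!natr1; ring.
Qed.

(** The tangent bound at the squares, combined with [x^2 - m^2 >= 2 m (x - m)]. Even exponents
    remove the sign conditions, so it applies to signed sums. *)
Lemma even_power_tangent (R : realFieldType) (k : nat) (x m : R) :
  m ^+ (2 * k) + (2 * k)%:R * m ^+ (2 * k).-1 * (x - m) <= x ^+ (2 * k).
Proof.
case: k => [|k]; first by rewrite muln0 !expr0 !mul0r addr0.
have := @power_tangent R k.+1 _ _ (sqr_ge0 x) (sqr_ge0 m).
have -> : k.+1.-1 = k by [].
rewrite -!exprM => /(le_trans _); apply.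
have -> : (2 * k.+1).-1 = (2 * k).+1 by lia.
rewrite lerD2l natrM exprS exprM.
have : 0 <= k.+1%:R * (m ^+ 2) ^+ k * (x - m) ^+ 2.
  by rewrite mulr_ge0 ?sqr_ge0 // mulr_ge0 // exprn_ge0 // sqr_ge0.
move=> h; rewrite -subr_ge0; apply: le_trans h _.
rewrite -exprM le_eqVlt; apply/orP; left; apply/eqP; rewrite -!natr1; ring.
Qed.

(** Jensen's inequality with denominators cleared: the tangent bounds at the weighted mean [mu] are
    averaged, and their linear terms cancel. *)
Lemma power_mean (R : realFieldType) (I : finType) (k : nat) (w a : I -> R) :
  (forall i, 0 <= w i) -> (forall i, 0 <= a i) -> 0 < \sum_i w i ->
  (\sum_i w i) * (\sum_i w i * a i) ^+ k
    <= (\sum_i w i) ^+ k * \sum_i w i * a i ^+ k.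
Proof.
move=> w0 a0; set W := \sum_i w i => W0.
pose mu := (\sum_i w i * a i) / W.
have Emu : \sum_i w i * a i = W * mu by rewrite /mu mulrCA mulfV ?mulr1 ?gt_eqF.
have mu0 : 0 <= mu.
  by rewrite divr_ge0 ?(ltW W0) // sumr_ge0 // => i _; rewrite mulr_ge0.
rewrite Emu exprMn mulrCA ler_wpM2l ?exprn_ge0 ?(ltW W0) //.
have -> : W * mu ^+ k
    = \sum_i w i * (mu ^+ k + k%:R * mu ^+ k.-1 * (a i - mu)).
  under eq_bigr do rewrite mulrDr mulrCA mulrBr.
  rewrite big_split /= -mulr_suml -mulr_sumr sumrB -mulr_suml Emu.
  by rewrite /W subrr mulr0 addr0.
by apply: ler_sum => i _; rewrite ler_wpM2l // power_tangent.
Qed.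

Lemma sum_even_odd (V : zmodType) (F : nat -> V) (k : nat) :
  \sum_(0 <= i < (2 * k).+1) F i
    = \sum_(0 <= j < k.+1) F (2 * j)%N + \sum_(0 <= j < k) F (2 * j).+1.
Proof.
elim: k => [|k IH]; first by rewrite muln0 !big_nat1 big_geq // addr0.
rewrite mulnS !add2n big_nat_recr // big_nat_recr //= IH.
rewrite [in RHS]big_nat_recr // [X in _ = _ + X]big_nat_recr //=.
by rewrite mulnS add2n [RHS]addrACA [X in _ = _ + X]addrC !addrA.
Qed.

Lemma even_binomial (R : comRingType) (y d : R) (k : nat) :
  (y + d) ^+ (2 * k) + (y - d) ^+ (2 * k)
    = 2 * \sum_(0 <= j < k.+1)
            'C(2 * k, 2 * j)%:R * (d ^+ (2 * j) * y ^+ (2 * (k - j))).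
Proof.
rewrite !exprDn -big_split /=.
rewrite -(big_mkord xpredT (fun i => y ^+ (2 * k - i) * d ^+ i *+ 'C(2 * k, i)
   + y ^+ (2 * k - i) * (- d) ^+ i *+ 'C(2 * k, i))).
rewrite sum_even_odd [X in _ + X]big1 => [|j _]; last first.
  rewrite !exprS !exprM sqrrN; rewrite -mulrnDl -mulrDr mulNr subrr.
  by rewrite mulr0 mul0rn.
rewrite addr0 mulr_sumr; apply: eq_bigr => j _.
by rewrite !exprM sqrrN -exprM -mulnBr -mulr_natl -exprM; ring.
Qed.

(** With [(2 l) ^_ l = (2 l)! / l!], the sides become [(2k)! / ((2j)! (k-j)!)] and
    [(2k)! / (j! (k-j)!)], which leaves [j! <= (2j)!]. This compares the [j]-th binomial terms in
    the Khinchine induction. *)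
Lemma khinchine_constant (k j : nat) : (j <= k)%N ->
  ('C(2 * k, 2 * j) * (2 * (k - j)) ^_ (k - j) <= (2 * k) ^_ k * 'C(k, j))%N.
Proof.
move=> jk.
have p : (0 < (2 * j)`! * (k - j)`!)%N by rewrite muln_gt0 !fact_gt0.
rewrite -(leq_pmul2r p).
have E1 : ((2 * (k - j)) ^_ (k - j) * (k - j)`! = (2 * (k - j))`!)%N.
  rewrite -[RHS](@ffact_fact _ (k - j)); last by lia.
  by congr (_ * _`!)%N; lia.
have E2 : ((2 * k) ^_ k * k`! = (2 * k)`!)%N.
  rewrite -[RHS](@ffact_fact _ k); last by lia.
  by congr (_ * _`!)%N; lia.
have E3 : ('C(2 * k, 2 * j) * ((2 * j)`! * (2 * (k - j))`!) = (2 * k)`!)%N.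
  by rewrite mulnBr bin_fact //; lia.
have E4 : ('C(k, j) * (j`! * (k - j)`!) = k`!)%N by rewrite bin_fact.
have E5 : (j`! <= (2 * j)`!)%N.
  have <- : ((2 * j) ^_ j * j`! = (2 * j)`!)%N.
    rewrite -[RHS](@ffact_fact _ j); last by lia.
    by congr (_ * _`!)%N; lia.
  by rewrite leq_pmull // ffact_gt0; lia.
have -> : ('C(2 * k, 2 * j) * (2 * (k - j)) ^_ (k - j) * ((2 * j)`! * (k - j)`!)
   = (2 * k)`!)%N by rewrite -E3 -E1; lia.
have -> : ((2 * k) ^_ k * 'C(k, j) * ((2 * j)`! * (k - j)`!)
   = (2 * k) ^_ k * 'C(k, j) * (k - j)`! * (2 * j)`!)%N by lia.
rewrite -E2 -E4.
have -> : ((2 * k) ^_ k * ('C(k, j) * (j`! * (k - j)`!))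
   = (2 * k) ^_ k * 'C(k, j) * (k - j)`! * j`!)%N by lia.
by rewrite leq_mul2l E5 orbT.
Qed.

(* The weight [w] strengthens the induction: the even powers of the summand
   that is split off are absorbed into it. *)
Lemma khinchine (R : realFieldType) (T : finType) (I : eqType)
    (d : I -> T -> R) (tau : I -> T -> T) (s : seq I) (w : T -> R) (k : nat) :
  uniq s ->
  (forall i, injective (tau i)) ->
  (forall i p, d i (tau i p) = - d i p) ->
  (forall i j p, i != j -> d j (tau i p) = d j p) ->
  (forall p, 0 <= w p) ->
  (forall i p, i \in s -> w (tau i p) = w p) ->
  \sum_p w p * (\sum_(i <- s) d i p) ^+ (2 * k)
    <= ((2 * k) ^_ k)%:R * \sum_p w p * (\sum_(i <- s) d i p ^+ 2) ^+ k.
Proof.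
move=> us tinj dneg dinv.
elim: s us w k => [|i s IH] /=.
  move=> _ w k w0 _; case: k => [|k].
    by rewrite muln0 ffactn0 mul1r; apply: ler_sum => p _; rewrite !expr0.
  rewrite mulnS add2n; under eq_bigr do rewrite big_nil exprS mul0r mulr0.
  rewrite sumr_const mul0rn mulr_ge0 ?ler0n //.
  by apply: sumr_ge0 => p _; rewrite big_nil exprS mul0r mulr0.
move=> /andP[nis us] w k w0 winv.
pose Y p := \sum_(j <- s) d j p; pose Z p := \sum_(j <- s) d j p ^+ 2.
have Yinv p : Y (tau i p) = Y p.
  apply: eq_big_seq => j js; apply: dinv; apply: contraNneq nis => -> //.
under eq_bigr do rewrite big_cons -/(Y _).
under [in leRHS]eq_bigr do rewrite big_cons -/(Z _).
(* The bijection [tau i] negates [d i] and preserves [w] and [Y], so both signs of [d i] give the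
   same sum; averaging them keeps only the even powers of [d i]. *)
have E : \sum_p w p * (d i p + Y p) ^+ (2 * k)
  = \sum_p w p * (Y p - d i p) ^+ (2 * k).
  rewrite (reindex_inj (tinj i)) /=; apply: eq_bigr => p _.
  by rewrite winv ?mem_head // dneg Yinv addrC.
have -> : \sum_p w p * (d i p + Y p) ^+ (2 * k)
  = \sum_(0 <= j < k.+1) 'C(2 * k, 2 * j)%:R *
     \sum_p (w p * d i p ^+ (2 * j)) * Y p ^+ (2 * (k - j)).
  apply: (@mulfI _ 2); first by rewrite pnatr_eq0.
  rewrite mulr2n mulrDl mul1r {2}E -big_split /=.
  under eq_bigr do rewrite -mulrDr [d _ _ + _]addrC even_binomial mulrCA mulr_sumr.
  rewrite -mulr_sumr exchange_big /=; congr (_ * _).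
  apply: eq_bigr => j _; rewrite mulr_sumr; apply: eq_bigr => p _; ring.
under [in leRHS]eq_bigr do rewrite addrC exprDn mulr_sumr.
rewrite exchange_big /= mulr_sumr -(big_mkord xpredT (fun j => _ *
  \sum_p w p * (Z p ^+ (k - j) * (d i p ^+ 2) ^+ j *+ 'C(k, j)))).
rewrite !big_nat; apply: ler_sum => j /= jk.
apply: le_trans (ler_wpM2l (ler0n _ _)
  (IH us (fun p => w p * d i p ^+ (2 * j)) (k - j)%N _ _)) _ => [p|l p ls|].
  - by rewrite mulr_ge0 // exprM exprn_ge0 // sqr_ge0.
  - rewrite winv ?inE ?ls ?orbT // dinv //.
    by apply: contraNneq nis => <-.
  rewrite mulrA -natrM.
  under [X in _ <= _ * X]eq_bigr do rewrite -mulr_natl mulrCA.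
  rewrite -mulr_sumr mulrA -natrM.
  have -> : \sum_p w p * (Z p ^+ (k - j) * (d i p ^+ 2) ^+ j)
    = \sum_p w p * d i p ^+ (2 * j) * Z p ^+ (k - j).
    by apply: eq_bigr => p _; rewrite exprM; ring.
  apply: ler_wpM2r; last by rewrite ler_nat khinchine_constant.
  apply: sumr_ge0 => p _; rewrite exprM.
  apply: mulr_ge0; first by rewrite mulr_ge0 // exprn_ge0 // sqr_ge0.
  by rewrite exprn_ge0 // sumr_ge0 // => l _; rewrite sqr_ge0.
Qed.

(** * Elementary symmetric polynomials *)

Lemma ffact_le_exp (n k : nat) : (n ^_ k <= n ^ k)%N.
Proof.
elim: k => [|k IH]; first by rewrite ffactn0 expn0.
by rewrite ffactnSr expnSr leq_mul // leq_subr.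
Qed.

Lemma bin_le_exp (n k : nat) : ('C(n, k) <= n ^ k)%N.
Proof.
apply: leq_trans (ffact_le_exp n k).
by rewrite -bin_ffact leq_pmulr // fact_gt0.
Qed.

(** This is the partial derivative of [elem_sym k.+1] in the variable [z j], the intermediate object
    for Newton's identities. *)
Definition elem_sym_omit (R : realType) (m : nat) (j : 'I_m) (k : nat)
    (z : 'I_m -> R) : R :=
  \sum_(I : {set 'I_m} | (#|I| == k) && (j \notin I)) \prod_(i in I) z i.

Lemma elem_sym0 (R : realType) (m : nat) (z : 'I_m -> R) : elem_sym 0 z = 1.
Proof.
rewrite /elem_sym (big_pred1 finset.set0) ?big_set0 // => I.
by rewrite cards_eq0.
Qed.

Lemma elem_sym_omit0 (R : realType) (m : nat) (j : 'I_m) (z : 'I_m -> R) :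
  elem_sym_omit j 0 z = 1.
Proof.
rewrite /elem_sym_omit (big_pred1 finset.set0) ?big_set0 // => I /=.
by rewrite cards_eq0; case: eqP => [->|]; rewrite ?inE.
Qed.

Lemma sum_sets_with (R : realType) (m : nat) (j : 'I_m) (k : nat)
    (z : 'I_m -> R) :
  \sum_(I : {set 'I_m} | (#|I| == k.+1) && (j \in I)) \prod_(i in I) z i
    = z j * elem_sym_omit j k z.
Proof.
rewrite /elem_sym_omit mulr_sumr.
rewrite (reindex_onto (fun I : {set 'I_m} => (j |: I)%SET)
          (fun I => (I :\ j)%SET)) /=; last first.
  by move=> I /andP[_ jI]; rewrite setD1K.
apply: eq_big => [I|I /andP[/andP[_ _] /eqP jI]].
  have [jI|jI] := boolP (j \in I).
    rewrite andbF; apply/negbTE; rewrite negb_and; apply/orP; right.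
    by apply: contraTneq jI => <-; rewrite !inE eqxx.
  by rewrite setU11 !andbT setU1K // eqxx andbT cardsU1 jI.
have {}jI : j \notin I by rewrite -jI !inE eqxx.
by rewrite big_setU1.
Qed.

Lemma elem_symS (R : realType) (m : nat) (j : 'I_m) (k : nat) (z : 'I_m -> R) :
  elem_sym k.+1 z = elem_sym_omit j k.+1 z + z j * elem_sym_omit j k z.
Proof.
rewrite -sum_sets_with addrC /elem_sym.
by rewrite (bigID (fun I : {set 'I_m} => j \in I)).
Qed.

(** [elem_symS], solved for its omitted polynomial of degree [k.+1], is a recurrence in [k];
    unrolling it gives the alternating sum. *)
Lemma elem_sym_omitE (R : realType) (m : nat) (j : 'I_m) (k : nat)
    (z : 'I_m -> R) :
  elem_sym_omit j k z
    = \sum_(0 <= i < k.+1) (- z j) ^+ i * elem_sym (k - i) z.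
Proof.
elim: k => [|k IH].
  by rewrite big_nat1 elem_sym0 elem_sym_omit0 mulr1.
rewrite big_nat_recl // expr0 mul1r (elem_symS j) -addrA.
rewrite [X in _ + X](_ : _ = 0) ?addr0 // IH mulr_sumr -big_split big1 //= => i _.
by rewrite subSS exprS; ring.
Qed.

(** Double counting: a set of size [k.+1] arises once for each choice of its member [j]. *)
Lemma sum_elem_sym_omit (R : realType) (m k : nat) (z : 'I_m -> R) :
  k.+1%:R * elem_sym k.+1 z = \sum_j z j * elem_sym_omit j k z.
Proof.
under [RHS]eq_bigr do rewrite -sum_sets_with.
rewrite (exchange_big_dep (fun I : {set 'I_m} => #|I| == k.+1)) /=; last first.
  by move=> j I _ /andP[].
rewrite /elem_sym mulr_sumr; apply: eq_bigr => I /eqP cI.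
by rewrite cI eqxx /= sumr_const cI mulr_natl.
Qed.

Lemma newton_identity (R : realType) (m k : nat) (z : 'I_m -> R) :
  k.+1%:R * elem_sym k.+1 z
    = \sum_(0 <= i < k.+1) (-1) ^+ i * (\sum_j z j ^+ i.+1) * elem_sym (k - i) z.
Proof.
rewrite sum_elem_sym_omit.
under eq_bigr do rewrite elem_sym_omitE mulr_sumr.
rewrite exchange_big /=; apply: eq_bigr => i _.
rewrite [X in _ = X * _]mulr_sumr mulr_suml; apply: eq_bigr => j _.
by rewrite [(- z j) ^+ i]exprNn exprS; ring.
Qed.

(** The bound on the squares forces [|z j| <= M] for every [j]. For exponents of at least 2, a
    square is split off each power and the remaining factor is at most a power of [M]. *)
Lemma power_sum_bound (R : realType) (m k : nat) (z : 'I_m -> R) (M : R) :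
  0 <= M -> `|\sum_j z j| <= M -> \sum_j z j ^+ 2 <= M ^+ 2 ->
  `|\sum_j z j ^+ k.+1| <= M ^+ k.+1.
Proof.
move=> M0 h1 h2; case: k => [|k].
  by under eq_bigr do rewrite expr1; rewrite expr1.
have zM j : `|z j| <= M.
  rewrite -(@ler_pXn2r _ 2) ?nnegrE // real_normK ?num_real //.
  apply: le_trans h2; rewrite (bigD1 j) //= lerDl sumr_ge0 // => i _.
  exact: sqr_ge0.
apply: le_trans (ler_norm_sum _ _ _) _.
rewrite (_ : k.+2 = 2 + k)%N // [leRHS]exprD.
apply: le_trans (ler_wpM2r (exprn_ge0 k M0) h2); rewrite mulr_suml.
apply: ler_sum => j _; rewrite exprD normrM [`|_ ^+ 2|]ger0_norm ?sqr_ge0 //.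
by rewrite ler_wpM2l ?sqr_ge0 // normrX lerXn2r ?nnegrE.
Qed.

(** Strong induction through Newton's identity: each of its [k.+1] summands is at most [M ^+ k.+1],
    and the factor [k.+1] on the left cancels their number, so no dependence on [m] enters. *)
Lemma elem_sym_bound (R : realType) (m k : nat) (z : 'I_m -> R) (M : R) :
  0 <= M -> `|\sum_j z j| <= M -> \sum_j z j ^+ 2 <= M ^+ 2 ->
  `|elem_sym k z| <= M ^+ k.
Proof.
move=> M0 h1 h2; elim/ltn_ind: k => -[|k] IH.
  by rewrite elem_sym0 normr1.
rewrite -(@ler_pM2l _ k.+1%:R) ?ltr0n // -[X in X * _]normr_nat -normrM.
rewrite newton_identity; apply: le_trans (ler_norm_sum _ _ _) _.
have -> : k.+1%:R * M ^+ k.+1 = \sum_(0 <= i < k.+1) M ^+ k.+1.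
  by rewrite sumr_const_nat subn0 mulr_natl.
rewrite !big_nat.
apply: ler_sum => i /= ik.
rewrite !normrM normrX normrN1 expr1n mul1r.
rewrite (_ : k.+1 = i.+1 + (k - i))%N; last by lia.
rewrite exprD ler_pM // ?power_sum_bound // IH //; lia.
Qed.

(** * Expectations and Fourier L1 norms on the cube *)

Lemma expectUE (R : realType) (n : nat) (h : cube n -> R) :
  expectU h = (#|cube n|%:R)^-1 * \sum_x h x.
Proof. by rewrite /expectU /expect mulr_sumr. Qed.

Lemma sumE_expectU (R : realType) (n : nat) (h : cube n -> R) :
  \sum_x h x = #|cube n|%:R * expectU h.
Proof. by rewrite expectUE mulrA mulfV ?mul1r // card_cube_neq0. Qed.

Lemma expectD (R : realType) (n : nat) (D : distr R n) (f h : cube n -> R) :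
  expect D (fun x => f x + h x) = expect D f + expect D h.
Proof. by rewrite -big_split; apply: eq_bigr => x _; rewrite mulrDr. Qed.

Lemma expectZ (R : realType) (n : nat) (D : distr R n) (a : R)
    (h : cube n -> R) :
  expect D (fun x => a * h x) = a * expect D h.
Proof. by rewrite [RHS]mulr_sumr; apply: eq_bigr => x _; rewrite mulrCA. Qed.

Lemma expect_const (R : realType) (n : nat) (D : distr R n) (a : R) :
  expect D (fun=> a) = a.
Proof. by rewrite /expect -mulr_suml mass_sum1 mul1r. Qed.

Lemma expect_sum (R : realType) (n : nat) (D : distr R n) (A : Type)
    (r : seq A) (Q : pred A) (h : A -> cube n -> R) :
  expect D (fun x => \sum_(a <- r | Q a) h a x)
    = \sum_(a <- r | Q a) expect D (h a).
Proof.
rewrite /expect exchange_big /=; apply: eq_bigr => x _.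
by rewrite mulr_sumr.
Qed.

Lemma expect_le (R : realType) (n : nat) (D : distr R n) (f h : cube n -> R) :
  (forall x, f x <= h x) -> expect D f <= expect D h.
Proof. by move=> fh; apply: ler_sum => x _; rewrite ler_wpM2l ?mass_ge0. Qed.

Lemma eq_expect (R : realType) (n : nat) (D : distr R n) (f h : cube n -> R) :
  f =1 h -> expect D f = expect D h.
Proof. by move=> fh; apply: eq_bigr => x _; rewrite fh. Qed.

Lemma chi0 (R : realType) (n : nat) (x : cube n) : chi R finset.set0 x = 1.
Proof. by rewrite /chi big_set0. Qed.

Lemma chi_symdiff (R : realType) (n : nat) (I J : {set 'I_n}) (x : cube n) :
  chi R I x * chi R J x = chi R ((I :\: J) :|: (J :\: I))%SET x.
Proof.
rewrite /chi !(big_mkcond (fun i => i \in _)) -big_split.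
apply: eq_bigr => i _; rewrite !inE /coordinate.
by case: (i \in I) (i \in J) (x i) => [] [] [] /=;
  rewrite ?expr0 ?expr1 ?mulrNN ?mulr1 ?mul1r.
Qed.

(** Characters may repeat in the given expansion; collecting equal ones only lowers the sum of
    absolute values. This is what makes the norm submultiplicative. *)
Lemma L1norm_le_sum (R : realType) (n : nat) (A : finType) (w : A -> R)
    (J : A -> {set 'I_n}) (h : cube n -> R) :
  (forall x, h x = \sum_a w a * chi R (J a) x) -> L1norm h <= \sum_a `|w a|.
Proof.
move=> hE.
have e : is_expansion h [ffun K => \sum_(a | J a == K) w a].
  move=> x; rewrite hE (partition_big J xpredT) //=; apply: eq_bigr => K _.
  by rewrite ffunE mulr_suml; apply: eq_bigr => a /eqP ->.
rewrite /L1norm (expansion_unique (fourierP h) e).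
rewrite [leRHS](partition_big J xpredT) //=; apply: ler_sum => K _.
by rewrite ffunE ler_norm_sum.
Qed.

Lemma L1norm_ge0 (R : realType) (n : nat) (h : cube n -> R) : 0 <= L1norm h.
Proof. by apply: sumr_ge0 => I _; rewrite normr_ge0. Qed.

Lemma eq_L1norm (R : realType) (n : nat) (f h : cube n -> R) :
  f =1 h -> L1norm f = L1norm h.
Proof.
move=> fh; rewrite /L1norm; rewrite (_ : fourier f = fourier h) //.
apply: (expansion_unique (fourierP f)) => x.
by rewrite fh; apply: fourierP.
Qed.

Lemma L1norm_const (R : realType) (n : nat) (a : R) :
  L1norm (fun _ : cube n => a) <= `|a|.
Proof.
apply: le_trans (@L1norm_le_sum R n 'I_1 (fun=> a) (fun=> finset.set0) _ _) _.
  by move=> x; rewrite big_ord1 chi0 mulr1.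
by rewrite big_ord1.
Qed.

Lemma L1normD (R : realType) (n : nat) (f h : cube n -> R) :
  L1norm (fun x => f x + h x) <= L1norm f + L1norm h.
Proof.
rewrite /L1norm -big_split /=.
have e : is_expansion (fun x => f x + h x) [ffun I => fourier f I + fourier h I].
  move=> x; rewrite fourierP (fourierP h) -big_split; apply: eq_bigr => I _.
  by rewrite ffunE mulrDl.
rewrite (expansion_unique (fourierP _) e); apply: ler_sum => I _.
by rewrite ffunE ler_normD.
Qed.

Lemma L1normM (R : realType) (n : nat) (f h : cube n -> R) :
  L1norm (fun x => f x * h x) <= L1norm f * L1norm h.
Proof.
apply: le_trans (@L1norm_le_sum R n ({set 'I_n} * {set 'I_n})%type
  (fun p => fourier f p.1 * fourier h p.2)
  (fun p => (p.1 :\: p.2) :|: (p.2 :\: p.1))%SET _ _) _.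
  move=> x; rewrite fourierP (fourierP h) big_distrlr pair_bigA /=.
  by apply: eq_bigr => -[I J] _ /=; rewrite -chi_symdiff mulrACA.
rewrite /L1norm big_distrlr pair_bigA /=.
by apply: ler_sum => -[I J] _; rewrite normrM.
Qed.

Lemma L1normZ (R : realType) (n : nat) (a : R) (h : cube n -> R) :
  L1norm (fun x => a * h x) <= `|a| * L1norm h.
Proof.
apply: le_trans (L1normM _ _) _.
by rewrite ler_wpM2r ?L1norm_ge0 // L1norm_const.
Qed.

Lemma L1norm_sum (R : realType) (n : nat) (A : Type) (r : seq A)
    (Q : pred A) (h : A -> cube n -> R) :
  L1norm (fun x => \sum_(a <- r | Q a) h a x)
    <= \sum_(a <- r | Q a) L1norm (h a).
Proof.
elim: r => [|a r IH].
  rewrite big_nil (@eq_L1norm _ _ _ (fun=> 0)) ?(le_trans (L1norm_const _ _)) //.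
    by rewrite normr0.
  by move=> x; rewrite big_nil.
rewrite big_cons; case: ifP => Qa.
  rewrite (@eq_L1norm _ _ _ (fun x => h a x + \sum_(a <- r | Q a) h a x)).
    by apply: le_trans (L1normD _ _) _; rewrite lerD2l.
  by move=> x; rewrite big_cons Qa.
rewrite (@eq_L1norm _ _ _ (fun x => \sum_(a <- r | Q a) h a x)) //.
by move=> x; rewrite big_cons Qa.
Qed.

Lemma L1norm_prod (R : realType) (n : nat) (A : Type) (r : seq A)
    (Q : pred A) (h : A -> cube n -> R) :
  L1norm (fun x => \prod_(a <- r | Q a) h a x)
    <= \prod_(a <- r | Q a) L1norm (h a).
Proof.
elim: r => [|a r IH].
  rewrite big_nil (@eq_L1norm _ _ _ (fun=> 1)) ?(le_trans (L1norm_const _ _)) //.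
    by rewrite normr1.
  by move=> x; rewrite big_nil.
rewrite big_cons; case: ifP => Qa.
  rewrite (@eq_L1norm _ _ _ (fun x => h a x * \prod_(a <- r | Q a) h a x)).
    by apply: le_trans (L1normM _ _) _; rewrite ler_wpM2l ?L1norm_ge0.
  by move=> x; rewrite big_cons Qa.
rewrite (@eq_L1norm _ _ _ (fun x => \prod_(a <- r | Q a) h a x)) //.
by move=> x; rewrite big_cons Qa.
Qed.

Lemma L1normX (R : realType) (n k : nat) (h : cube n -> R) :
  L1norm (fun x => h x ^+ k) <= L1norm h ^+ k.
Proof.
have := L1norm_prod (index_iota 0 k) xpredT (fun=> h).
rewrite prodr_const_nat subn0; apply: le_trans.
rewrite le_eqVlt (@eq_L1norm _ _ _ (fun x => h x ^+ k)) ?eqxx // => x.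
by rewrite prodr_const_nat subn0.
Qed.

(** Expand over characters: the empty one cancels, and every other has uniform mean 0 and [D]-mean
    at most [eps] in absolute value. *)
Lemma expect_biased (R : realType) (n : nat) (eps : R) (D : distr R n)
    (h : cube n -> R) :
  biased eps D -> 0 <= eps ->
  `|expect D h - expectU h| <= eps * L1norm h.
Proof.
move=> bD eps0.
have E : forall D' : distr R n,
    expect D' h = \sum_I fourier h I * expect D' (chi R I).
  move=> D'; rewrite (eq_expect _ (fourierP h)) expect_sum.
  by apply: eq_bigr => I _; rewrite expectZ.
rewrite /expectU !E -sumrB /L1norm mulr_sumr.
apply: le_trans (ler_norm_sum _ _ _) _; apply: ler_sum => I _.
rewrite -mulrBr normrM mulrC ler_wpM2r //.
have chiE (D' : distr R n) : expect D' (chi R finset.set0) = 1.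
  by rewrite (eq_expect _ (@chi0 R n)) expect_const.
have [->|I0] := eqVneq I finset.set0.
  by rewrite !chiE subrr normr0.
suff -> : expect (uniform R n) (chi R I) = 0 by rewrite subr0; apply: bD.
rewrite -/(expectU _) expectUE.
rewrite (eq_bigr (fun x => chi R I x * chi R finset.set0 x)).
  by rewrite chi_orthogonal (negbTE I0) mulr0.
by move=> x _; rewrite chi0 mulr1.
Qed.

(** The [D]-mean of [f] lies between those of [fl] and [fu]. Each of these is within [eps * v] of
    its uniform mean, and the two uniform means enclose that of [f] with gap at most [a]. *)
Lemma sandwich_fools (R : realType) (n : nat) (eps a v : R) (D : distr R n)
    (f : cube n -> R) :
  biased eps D -> 0 <= eps -> has_sandwiching f a v ->
  `|expectU f - expect D f| <= a + eps * v.
Proof.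
move=> bD eps0 [fl [fu [sand diff Ll Lu]]].
have hl x : fl x <= f x by case/andP: (sand x).
have hu x : f x <= fu x by case/andP: (sand x).
have := expect_le (uniform R n) hl; have := expect_le (uniform R n) hu.
have := expect_le D hl; have := expect_le D hu.
have := ler_wpM2l eps0 Ll; have := ler_wpM2l eps0 Lu.
move: (expect_biased fl bD eps0) (expect_biased fu bD eps0).
rewrite !ler_norml /expectU in diff *.
by move=> /andP[? ?] /andP[? ?] *; lra.
Qed.

(** * Independence and moments *)

(** A measure-preserving involution on pairs of independent points. With [W = V i] it negates
    [g i p.1 - g i p.2] and, by disjointness, fixes the other differences. *)
Definition swap_coords (n : nat) (W : {set 'I_n}) (p : cube n * cube n) :
    cube n * cube n :=
  ([ffun j => if j \in W then p.2 j else p.1 j],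
   [ffun j => if j \in W then p.1 j else p.2 j]).

Lemma swap_coordsK (n : nat) (W : {set 'I_n}) : involutive (swap_coords W).
Proof.
by move=> [x y]; congr (_, _); apply/ffunP => j; rewrite !ffunE /= ?ffunE;
  case: (j \in W).
Qed.

Lemma swap_coords_in (R : realType) (n : nat) (W V : {set 'I_n})
    (h : cube n -> R) (p : cube n * cube n) :
  depends_only_on V h -> V \subset W ->
  h (swap_coords W p).1 = h p.2 /\ h (swap_coords W p).2 = h p.1.
Proof.
by move=> hV /subsetP VW; split; apply: hV => j /VW jW; rewrite ffunE jW.
Qed.

Lemma swap_coords_notin (R : realType) (n : nat) (W V : {set 'I_n})
    (h : cube n -> R) (p : cube n * cube n) :
  depends_only_on V h -> [disjoint W & V] ->
  h (swap_coords W p).1 = h p.1 /\ h (swap_coords W p).2 = h p.2.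
Proof.
move=> hV /pred0P WV; split; apply: hV => j jV; rewrite ffunE;
  by have := WV j; rewrite /= jV andbT => ->.
Qed.

(** Over pairs of points, the swap on [W] turns [f p.1 * h p.1] into [f p.2 * h p.1], whose sum
    factors. *)
Lemma expectU_indep (R : realType) (n : nat) (W V : {set 'I_n})
    (f h : cube n -> R) :
  depends_only_on W f -> depends_only_on V h -> [disjoint W & V] ->
  expectU (fun x => f x * h x) = expectU f * expectU h.
Proof.
move=> fW hV WV; set N : R := #|cube n|%:R.
have N0 : N != 0 by apply: card_cube_neq0.
suff E : N * \sum_x f x * h x = (\sum_x f x) * \sum_x h x.
  by rewrite !expectUE -/N mulrACA -E !mulrA divfK // .
transitivity (\sum_(p : cube n * cube n) f p.1 * h p.1).
  rewrite -(pair_bigA _ (fun x _ => f x * h x)) /= mulr_sumr.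
  by apply: eq_bigr => x _; rewrite sumr_const mulr_natl.
rewrite (reindex_inj (inv_inj (swap_coordsK W))) /=.
under eq_bigr => p _.
  rewrite (proj1 (swap_coords_in p fW (subxx W))).
  rewrite (proj1 (swap_coords_notin p hV WV)).
  over.
rewrite -(pair_bigA _ (fun x y => f y * h x)) /= exchange_big /=.
by rewrite big_distrlr.
Qed.

Lemma depends_only_on_prod (R : realType) (n m : nat) (V : 'I_m -> {set 'I_n})
    (g : 'I_m -> cube n -> R) (I : {set 'I_m}) :
  (forall i, depends_only_on (V i) (g i)) ->
  depends_only_on (\bigcup_(i in I) V i)%SET (fun x => \prod_(i in I) g i x).
Proof.
move=> gV x y xy; apply: eq_bigr => i iI; apply: gV => j jV; apply: xy.
by apply/bigcupP; exists i.
Qed.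

(** Every monomial has a nonempty index set, so independence splits off a mean-zero factor [g j]. *)
Lemma expectU_elem_sym (R : realType) (n m i : nat) (V : 'I_m -> {set 'I_n})
    (g : 'I_m -> cube n -> R) :
  (forall i j : 'I_m, i != j -> [disjoint V i & V j]) ->
  (forall i, depends_only_on (V i) (g i)) ->
  (forall i, expectU (g i) = 0) ->
  expectU (fun x => elem_sym i.+1 (fun j => g j x)) = 0.
Proof.
move=> dV gV g0; rewrite /expectU /elem_sym expect_sum big1 // => I /eqP cI.
have /set0Pn[j jI] : I != finset.set0 by rewrite -cards_eq0 cI.
rewrite (@eq_expect _ _ _ _ (fun x => g j x * \prod_(l in (I :\ j)%SET) g l x)).
  rewrite -/(expectU _) (expectU_indep (gV j)
    (@depends_only_on_prod _ _ _ V g (I :\ j)%SET gV)) ?g0 ?mul0r //.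
  apply/pred0P => l /=; apply/negP => /andP[lj /bigcupP[a]].
  rewrite !inE => /andP[aj _] la; have /pred0P/(_ l) := dV _ _ aj.
  by rewrite /= la lj.
by move=> x; rewrite (big_setD1 j).
Qed.

(** Symmetrization: [Y x] is replaced by [Y x - Y y] with [y] independent of [x], whose summands
    admit the sign flips required by [khinchine]. The factor [2 * 4 ^+ k] is the cost of returning
    to a single copy. *)
Lemma sum_moment_le (R : realType) (n m k : nat) (V : 'I_m -> {set 'I_n})
    (g : 'I_m -> cube n -> R) :
  (forall i j : 'I_m, i != j -> [disjoint V i & V j]) ->
  (forall i, depends_only_on (V i) (g i)) ->
  (forall i, expectU (g i) = 0) ->
  expectU (fun x => (\sum_i g i x) ^+ (2 * k))
    <= 2 * 4 ^+ k * ((2 * k) ^_ k)%:R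
       * expectU (fun x => (\sum_i g i x ^+ 2) ^+ k).
Proof.
move=> dV gV g0; set N : R := #|cube n|%:R; pose Y x := \sum_i g i x.
pose Z x := \sum_i g i x ^+ 2.
have Npos : 0 < N by rewrite lt_neqAle ler0n andbT eq_sym card_cube_neq0.
have Z0 x : 0 <= Z x by apply: sumr_ge0 => i _; apply: sqr_ge0.
have EY : \sum_x Y x = 0.
  rewrite exchange_big big1 //= => i _.
  by rewrite sumE_expectU g0 mulr0.
pose d i (p : cube n * cube n) := g i p.1 - g i p.2.
pose D := (fun p : cube n * cube n => \sum_i d i p).
(* Jensen over the second point: the linear term of the tangent at [Y x] sums to zero because [Y]
   has mean zero. *)
have h1 : N * \sum_x Y x ^+ (2 * k) <= \sum_p D p ^+ (2 * k).
  rewrite -(pair_bigA _ (fun x y => D (x, y) ^+ (2 * k))) /= mulr_sumr.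
  apply: ler_sum => x _.
  have -> : N * Y x ^+ (2 * k)
    = \sum_y (Y x ^+ (2 * k) + (2 * k)%:R * Y x ^+ (2 * k).-1 * (- Y y)).
    rewrite big_split /= sumr_const -mulr_sumr sumrN EY.
    by rewrite oppr0 mulr0 addr0 mulr_natl.
  apply: ler_sum => y _.
  have -> : D (x, y) = Y x - Y y by rewrite /D sumrB.
  have := even_power_tangent k (Y x - Y y) (Y x).
  by rewrite (_ : Y x - Y y - Y x = - Y y) //; ring.
have h2 : \sum_p D p ^+ (2 * k)
    <= ((2 * k) ^_ k)%:R * \sum_p (\sum_i d i p ^+ 2) ^+ k.
  have := @khinchine R _ _ d (fun i => swap_coords (V i)) (index_enum 'I_m)
    (fun=> 1) k (index_enum_uniq _).
  under eq_bigr do rewrite mul1r.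
  under [X in _ -> _ -> _ -> _ -> _ -> _ <= _ * X]eq_bigr do rewrite mul1r.
  apply => // [i|i p|i j p ij].
  - exact: inv_inj (swap_coordsK (V i)).
  - by rewrite /d; case: (swap_coords_in p (gV i) (subxx _)) => -> ->; rewrite opprB.
  - by rewrite /d; case: (swap_coords_notin p (gV j) (dV _ _ ij)) => -> ->.
have h3 : \sum_p (\sum_i d i p ^+ 2) ^+ k <= N * (2 * 4 ^+ k * \sum_x Z x ^+ k).
  apply: (@le_trans _ _
    (\sum_(p : cube n * cube n) 4 ^+ k * (Z p.1 ^+ k + Z p.2 ^+ k))).
    apply: ler_sum => p _.
    have le1 : \sum_i d i p ^+ 2 <= 2 * (Z p.1 + Z p.2).
      rewrite /Z -big_split mulr_sumr; apply: ler_sum => i _ /=.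
      by rewrite /d; have := sqr_ge0 (g i p.1 + g i p.2); nra.
    (* The [k]-th power of the maximum is at most the sum of the two [k]-th powers. *)
    have le2 : 2 * (Z p.1 + Z p.2) <= 4 * Num.max (Z p.1) (Z p.2).
      have : Z p.1 <= Num.max (Z p.1) (Z p.2) by rewrite le_max lexx.
      have : Z p.2 <= Num.max (Z p.1) (Z p.2) by rewrite le_max lexx orbT.
      by lra.
    have s0 : 0 <= \sum_i d i p ^+ 2 by apply: sumr_ge0 => i _; apply: sqr_ge0.
    have := lerXn2r k _ _ (le_trans le1 le2).
    rewrite !nnegrE s0 (le_trans s0 (le_trans le1 le2)) => /(_ isT isT).
    move=> /le_trans; apply; rewrite exprMn ler_wpM2l ?exprn_ge0 //.
    have := exprn_ge0 k (Z0 p.1); have := exprn_ge0 k (Z0 p.2).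
    by case: (leP (Z p.1) (Z p.2)) => _; lra.
  rewrite -(pair_bigA _ (fun x y => 4 ^+ k * (Z x ^+ k + Z y ^+ k))) /=.
  set S := \sum_x Z x ^+ k.
  rewrite (eq_bigr (fun x => 4 ^+ k * (N * Z x ^+ k + S))) => [|x _]; last first.
    by rewrite -mulr_sumr big_split /= sumr_const mulr_natl.
  rewrite -mulr_sumr big_split /= -mulr_sumr sumr_const -(mulr_natl S) -/S -/N.
  by rewrite le_eqVlt; apply/orP; left; apply/eqP; ring.
have h : N * \sum_x Y x ^+ (2 * k)
   <= N * (2 * 4 ^+ k * ((2 * k) ^_ k)%:R * \sum_x Z x ^+ k).
  apply: le_trans h1 (le_trans h2 _).
  apply: le_trans (ler_wpM2l (ler0n _ _) h3) _.
  by rewrite le_eqVlt; apply/orP; left; apply/eqP; ring.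
move: h; rewrite ler_pM2l // => h.
by rewrite !expectUE mulrCA ler_wpM2l // invr_ge0 ltW.
Qed.

(** Jensen with weights [sigma i ^+ 2] and values [g i x ^+ 2 / sigma i ^+ 2], normalized so that
    all their [k]-th moments share the bound [(2 * k)%:R ^+ (2 * k)]. *)
Lemma sum_sq_moment_le (R : realType) (n m k : nat)
    (g : 'I_m -> cube n -> R) (sigma : 'I_m -> R) :
  (0 < m)%N -> (0 < k)%N -> (forall i, 0 < sigma i) ->
  (forall i, expectU (fun x => g i x ^+ (2 * k))
       <= (2 * k)%:R ^+ (2 * k) * sigma i ^+ (2 * k)) ->
  expectU (fun x => (\sum_i g i x ^+ 2) ^+ k)
    <= (2 * k)%:R ^+ (2 * k) * (\sum_i sigma i ^+ 2) ^+ k.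
Proof.
move=> m0 k0 s0 mom; set s := \sum_i sigma i ^+ 2.
have spos : 0 < s.
  rewrite /s (bigD1 (Ordinal m0)) //= ltr_wpDr ?exprn_gt0 //.
  by apply: sumr_ge0 => i _; apply: sqr_ge0.
rewrite -(ler_pM2l spos) -[X in X <= _]expectZ.
have pt x : s * (\sum_i g i x ^+ 2) ^+ k
    <= s ^+ k * \sum_i sigma i ^+ 2 * (g i x ^+ 2 / sigma i ^+ 2) ^+ k.
  have := @power_mean R _ k (fun i => sigma i ^+ 2)
    (fun i => g i x ^+ 2 / sigma i ^+ 2).
  have -> : \sum_i sigma i ^+ 2 * (g i x ^+ 2 / sigma i ^+ 2) = \sum_i g i x ^+ 2.
    apply: eq_bigr => i _.
    by rewrite mulrCA mulfV ?mulr1 // expf_neq0 // gt_eqF.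
  by apply => // i; rewrite ?divr_ge0 ?sqr_ge0.
apply: le_trans (expect_le _ pt) _.
rewrite expectZ expect_sum [s * (_ * _)](_ : _ =
  s ^+ k * ((2 * k)%:R ^+ (2 * k) * s)); last by ring.
rewrite ler_wpM2l ?exprn_ge0 ?(ltW spos) // mulr_sumr; apply: ler_sum => i _.
rewrite expectZ mulrC ler_wpM2r ?sqr_ge0 //.
rewrite (@eq_expect _ _ _ _ (fun x => (sigma i ^+ (2 * k))^-1 * g i x ^+ (2 * k))).
  by rewrite expectZ mulrC ler_pdivrMr ?exprn_gt0 //; apply: mom.
by move=> x; rewrite expr_div_n -!exprM mulrC.
Qed.

(** * Consequences of the choice of k *)

Lemma exp_le_log2 (R : realType) (k : nat) (x : R) :
  0 < x -> k%:R <= log2 x -> 2 ^+ k <= x.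
Proof.
move=> x0; have ln2 : 0 < ln (2 : R) by rewrite ln_gt0 // ltr1n.
rewrite /log2 ler_pdivlMr // => h.
rewrite -ler_ln ?posrE ?exprn_gt0 // lnXn //. by rewrite -(mulr_natl (ln _)).
Qed.

Lemma log2_ge (R : realType) (k : nat) (x : R) :
  2 ^+ k <= x -> k%:R <= log2 x.
Proof.
move=> h; have x0 : 0 < x by apply: lt_le_trans h; rewrite exprn_gt0.
have ln2 : 0 < ln (2 : R) by rewrite ln_gt0 // ltr1n.
rewrite /log2 ler_pdivlMr // mulr_natl -lnXn //.
by rewrite ler_ln ?posrE ?exprn_gt0.
Qed.

(** Let [L = log2 (1 / delta)], at least 2, and [A = log2 (1 / s)]. Then [2^25 <= L^25 <= 1/s] gives
    [A >= 25], so [k < L/5 + 1 <= L] and [2^k <= 1/delta]. The ceiling also gives [k A >= 5 L], that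
    is [s^k <= delta^5]. *)
Lemma degree_estimates (R : realType) (s delta : R) (k : nat) :
  0 < s -> 0 < delta <= 1 / 4 ->
  s <= 1 / log2 (1 / delta) ^+ 25 ->
  k%:Z = Num.ceil (5 * log2 (1 / delta) / log2 (1 / s)) ->
  [/\ (0 < k)%N, 4 ^+ k <= delta ^- 2 & (128 * k%:R ^+ 3) ^+ k * s ^+ k <= delta].
Proof.
move=> s0 /andP[d0 d4]; set L := log2 (1 / delta) => sL kE.
have id0 : 0 < 1 / delta by rewrite divr_gt0.
have is0 : 0 < 1 / s by rewrite divr_gt0.
have L2 : 2 <= L.
  apply: log2_ge; rewrite ler_pdivlMr //; lra.
have L0 : 0 < L by lra.
have iL : L ^+ 25 <= 1 / s.
  by move: sL; rewrite ler_pdivlMr ?exprn_gt0 // => h; rewrite ler_pdivlMr // mulrC.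
have A25 : 25%:R <= log2 (1 / s).
  by apply: log2_ge; apply: le_trans iL; rewrite lerXn2r ?nnegrE // ltW.
set A := log2 (1 / s) in kE A25.
have A0 : 0 < A by apply: lt_le_trans A25.
have /andP[klo khi] := ceil_itv (5 * L / A); rewrite -kE in klo khi.
have k0 : (0 < k)%N.
  rewrite lt0n; apply/eqP => k0; move: khi; rewrite k0.
  by apply/negP; rewrite -ltNge divr_gt0 // mulr_gt0.
have kLA : 5 * L <= A * k%:R by rewrite [A * _]mulrC -ler_pdivrMr.
have kL : k%:R <= L.
  have : 5 * L / A <= L / 5.
    rewrite ler_pdivrMr // mulrAC ler_pdivlMr //; nra.
  move: klo; rewrite intrB /= => h1 h2.
  have : k%:R - 1 < L / 5 by apply: lt_le_trans h2.
  lra.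
have sk : s ^+ k <= delta ^+ 5.
  have ln2 : 0 < ln (2 : R) by rewrite ln_gt0 // ltr1n.
  rewrite -ler_ln ?posrE ?exprn_gt0 // !lnXn //.
  move: kLA; rewrite /L /A /log2 !div1r !lnV ?posrE //.
  rewrite mulrA [X in _ <= X]mulrAC ler_pM2r ?invr_gt0 //.
  rewrite -(mulr_natl (ln s)) -(mulr_natl (ln delta)); lra.
have k2 : 2 ^+ k <= 1 / delta by apply: exp_le_log2.
split => //.
  have -> : (4 : R) ^+ k = 2 ^+ k * 2 ^+ k by rewrite -exprMn; congr (_ ^+ _); lra.
  have -> : delta ^- 2 = (1 / delta) * (1 / delta) by rewrite !div1r -expr2 exprVn.
  by rewrite ler_pM ?exprn_ge0.
(* Here [128^2 = 2^14 <= L^18] and [k^6 <= L^6], so the product stays below [L^25 <= 1/s]. *)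
have h : (128 * k%:R ^+ 3) ^+ 2 * s <= 1.
  rewrite -ler_pdivlMr //; apply: le_trans iL.
  apply: (@le_trans _ _ (L ^+ 18 * L ^+ 6)); last first.
    rewrite -exprD ler_weXn2l //; lra.
  rewrite exprMn -exprM ler_pM ?exprn_ge0 ?ler0n ?mulr_ge0 //.
    have : (2 : R) ^+ 18 <= L ^+ 18 by rewrite lerXn2r ?nnegrE // ltW.
    by apply: le_trans; rewrite -!natrX ler_nat.
  by rewrite lerXn2r ?nnegrE ?ler0n // ltW.
have b0 : 0 <= 128 * k%:R ^+ 3 :> R by rewrite mulr_ge0 ?exprn_ge0 ?ler0n.
(* After squaring, one factor [s ^+ k] absorbs the powers of [128 * k%:R ^+ 3] and the other
   supplies [delta ^+ 5]. *)
rewrite -(@ler_pXn2r _ 2) ?nnegrE ?(ltW d0) //; last first.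
  by rewrite mulr_ge0 ?exprn_ge0 // ltW.
apply: (@le_trans _ _ (delta ^+ 5)); last first.
  by rewrite ler_wiXn2l // ltW //; lra.
apply: le_trans sk.
have -> : ((128 * k%:R ^+ 3) ^+ k * s ^+ k) ^+ 2
   = ((128 * k%:R ^+ 3) ^+ 2 * s) ^+ k * s ^+ k.
  by rewrite -!exprMn -exprM mulnC exprM; congr (_ ^+ k); ring.
apply: ler_piMl; first by rewrite exprn_ge0 // ltW.
apply: exprn_ile1 => //.
by rewrite mulr_ge0 ?exprn_ge0 // ltW.
Qed.

(** * The truncation error *)

Lemma geometric_tail_le (R : realFieldType) (M : R) (a N : nat) :
  0 <= M -> M <= 1 / 2 ->
  \sum_(0 <= i < N | (a <= i)%N) M ^+ i <= 2 * M ^+ a.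
Proof.
move=> M0 M2; have [Na|aN] := leqP N a.
  rewrite big_nat_cond big_pred0 ?mulr_ge0 ?exprn_ge0 // => i; lia.
(* Subtracting [2 * M ^+ N] makes the bound inductive: [M ^+ N <= 2 * M ^+ N - 2 * M ^+ N.+1] when
   [M <= 1 / 2]. *)
suff : \sum_(0 <= i < N | (a <= i)%N) M ^+ i <= 2 * M ^+ a - 2 * M ^+ N.
  by move=> /le_trans; apply; rewrite gerBl mulr_ge0 ?exprn_ge0.
rewrite -(subnKC (ltnW aN)); elim: (N - a)%N => [|b IH].
  rewrite addn0 subrr big_nat_cond big_pred0 // => i; lia.
rewrite addnS big_mkcond big_nat_recr //= -big_mkcond /= leq_addr.
by have := exprn_ge0 (a + b) M0; rewrite exprS; nra.
Qed.

(** Since [2 M >= 1], each [M^i] with [i < a] is at most [(2 M)^a 2^(-i)], and the weights [2^(-i)]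
    with [i >= 1] sum to at most 1. Index 0 is left out because [c 0] has its own bound. *)
Lemma geometric_head_le (R : realFieldType) (M : R) (a N : nat) :
  1 / 2 <= M -> \sum_(0 <= i < N | (0 < i < a)%N) M ^+ i <= (2 * M) ^+ a.
Proof.
move=> M2; have M0 : 0 <= M by lra.
have p : 0 <= (2 * M) ^+ a by apply: exprn_ge0; lra.
have half0 : 0 <= 1 / 2 :> R by lra.
apply: (@le_trans _ _ (\sum_(0 <= i < N | (0 < i)%N) (2 * M) ^+ a * (1 / 2) ^+ i)).
  rewrite big_mkcond [leRHS]big_mkcond; apply: ler_sum => i _.
  case: (posnP i) => //= i0; case: ifP => ia; last by rewrite mulr_ge0 // exprn_ge0.
  rewrite (_ : M ^+ i = (2 * M) ^+ i * (1 / 2) ^+ i); last first.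
    by rewrite -exprMn; congr (_ ^+ i); lra.
  rewrite ler_wpM2r ?exprn_ge0 // ler_weXn2l ?(ltnW ia) //; lra.
rewrite -mulr_sumr ler_piMr //.
apply: le_trans (geometric_tail_le 1 N half0 (lexx _)) _; rewrite expr1; lra.
Qed.

Lemma truncation_error_le (R : realType) (m k : nat) (z : 'I_m -> R)
    (c : nat -> R) (B C : R) :
  0 <= C ->
  (forall i : nat, (1 <= i <= m)%N -> `|c i| <= C) ->
  `|c 0%N| <= B ->
  `|\sum_(0 <= i < m.+1) c i * elem_sym i z| <= B ->
  (0 < k)%N ->
  `|\sum_(0 <= i < m.+1) c i * elem_sym i z
      - \sum_(0 <= i < m.+1 | (i < 2 * k)%N) c i * elem_sym i z|
    <= 2 * (B + C) * 4 ^+ k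
       * ((\sum_j z j) ^+ (2 * k) + (\sum_j z j ^+ 2) ^+ k).
Proof.
move=> C0 cC c0 PB k0.
have B0 : 0 <= B := le_trans (normr_ge0 _) c0.
set p1 := \sum_j z j; set p2 := \sum_j z j ^+ 2.
have p20 : 0 <= p2 by apply: sumr_ge0 => j _; apply: sqr_ge0.
pose M := Num.max `|p1| (Num.sqrt p2).
have M0 : 0 <= M by rewrite le_max normr_ge0.
have M1 : `|p1| <= M by rewrite le_max lexx.
have M2 : p2 <= M ^+ 2.
  by rewrite -[leLHS]sqr_sqrtr // lerXn2r ?nnegrE ?sqrtr_ge0 // le_max lexx orbT.
(* Replacing the maximum by a sum turns the error bound into a polynomial in [z], whose mean and L1
   norm can be estimated. *)
have Mk : M ^+ (2 * k) <= p1 ^+ (2 * k) + p2 ^+ k.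
  have a1 : 0 <= p1 ^+ (2 * k) by rewrite exprM exprn_ge0 // sqr_ge0.
  have a2 : 0 <= p2 ^+ k by apply: exprn_ge0.
  rewrite /M; case: (leP `|p1| (Num.sqrt p2)) => _.
    by rewrite exprM sqr_sqrtr //; lra.
  by rewrite exprM real_normK ?num_real // -exprM; lra.
have term i : (1 <= i < m.+1)%N -> `|c i * elem_sym i z| <= C * M ^+ i.
  by move=> im; rewrite normrM ler_pM // ?elem_sym_bound // cC.
suff h : `|\sum_(0 <= i < m.+1) c i * elem_sym i z
      - \sum_(0 <= i < m.+1 | (i < 2 * k)%N) c i * elem_sym i z|
    <= 2 * (B + C) * 4 ^+ k * M ^+ (2 * k).
  apply: le_trans h _; rewrite ler_wpM2l //.
  by rewrite !mulr_ge0 ?exprn_ge0 ?addr_ge0.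
have M2k := exprn_ge0 (2 * k) M0.
have [Mle|Mgt] := leP M (1 / 2).
  rewrite (bigID (fun i => (i < 2 * k)%N)) /= addrAC subrr add0r.
  apply: (@le_trans _ _ (\sum_(0 <= i < m.+1 | (2 * k <= i)%N) C * M ^+ i)).
    under eq_bigl do rewrite -leqNgt.
    apply: le_trans (ler_norm_sum _ _ _) _.
    rewrite big_nat_cond [leRHS]big_nat_cond; apply: ler_sum => i /= h.
    apply: term; lia.
  rewrite -mulr_sumr; have h := geometric_tail_le (2 * k) m.+1 M0 Mle.
  apply: le_trans (ler_wpM2l C0 h) _.
  have e4 : 1 <= 4 ^+ k :> R by rewrite exprn_ege1 // ler1n.
  have : C * (2 * M ^+ (2 * k)) <= (2 * (B + C)) * M ^+ (2 * k) by nra.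
  move=> /le_trans; apply; rewrite ler_wpM2r //.
  by rewrite ler_peMr // mulr_ge0 // addr_ge0.
have -> : 2 * (B + C) * 4 ^+ k * M ^+ (2 * k) = 2 * (B + C) * (2 * M) ^+ (2 * k).
  rewrite exprMn [2 ^+ _]exprM -mulrA; congr (_ * (_ ^+ _ * _)); lra.
have e2 : 1 <= (2 * M) ^+ (2 * k) by rewrite exprn_ege1 //; lra.
have h2 : `|\sum_(0 <= i < m.+1 | (i < 2 * k)%N) c i * elem_sym i z|
    <= B + C * (2 * M) ^+ (2 * k).
  (* Index 0 survives the truncation because [k > 0]; its term is [c 0], bounded by [B] rather than
     by [C]. *)
  rewrite big_mkcond big_nat_recl //= -big_mkcond muln_gt0 k0 elem_sym0 mulr1.
  apply: le_trans (ler_normD _ _) _; apply: lerD => //.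
  apply: le_trans (ler_norm_sum _ _ _) _.
  have h := geometric_head_le (2 * k) m.+1 (ltW Mgt).
  apply: le_trans (ler_wpM2l C0 h); rewrite mulr_sumr.
  rewrite [leRHS]big_mkcond big_nat_recl //= add0r -big_mkcond.
  rewrite big_nat_cond [leRHS]big_nat_cond; apply: ler_sum => i /= h'.
  apply: term; lia.
apply: le_trans (ler_normB _ _) _; nra.
Qed.

(** * Sandwiching approximations *)

Lemma L1norm_elem_sym (R : realType) (n m i : nat) (g : 'I_m -> cube n -> R)
    (t : R) :
  (forall j, L1norm (g j) <= t) ->
  L1norm (fun x => elem_sym i (fun j => g j x)) <= 'C(m, i)%:R * t ^+ i.
Proof.
move=> gt; apply: le_trans (L1norm_sum _ _ _) _.
apply: (@le_trans _ _ (\sum_(I : {set 'I_m} | #|I| == i) t ^+ i)).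
  apply: ler_sum => I /eqP <-; apply: le_trans (L1norm_prod _ _ _) _.
  by rewrite -prodr_const; apply: ler_prod => j _; rewrite L1norm_ge0 gt.
rewrite sumr_const mulr_natl (_ : #|_| = 'C(m, i)) //.
by rewrite -[X in 'C(X, _)](card_ord m) -card_draws cardsE.
Qed.

(** For [i < N], ['C(m, i) t^i <= (m t)^i <= (m t)^i 'C(N, i)], and the binomial theorem for
    [(m t + 1)^N] bounds the sum of these terms. *)
Lemma L1norm_truncation (R : realType) (n m N : nat) (g : 'I_m -> cube n -> R)
    (t K : R) (c : nat -> R) :
  0 <= t -> 0 <= K -> (forall j, L1norm (g j) <= t) ->
  (forall i, (i <= m)%N -> `|c i| <= K) ->
  L1norm (fun x => \sum_(0 <= i < m.+1 | (i < N)%N)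
                     c i * elem_sym i (fun j => g j x))
    <= K * (m%:R * t + 1) ^+ N.
Proof.
move=> t0 K0 gt cK; apply: le_trans (L1norm_sum _ _ _) _.
apply: (@le_trans _ _ (\sum_(0 <= i < m.+1 | (i < N)%N)
    K * ((m%:R * t) ^+ i *+ 'C(N, i)))).
  rewrite big_nat_cond [leRHS]big_nat_cond; apply: ler_sum => i /andP[im iN].
  apply: le_trans (L1normZ _ _) _; apply: ler_pM; rewrite ?L1norm_ge0 ?cK //.
  apply: le_trans (L1norm_elem_sym i gt) _.
  rewrite exprMn -natrX -mulrnAl -mulrnA.
  rewrite ler_wpM2r ?exprn_ge0 // ler_nat.
  apply: leq_trans (bin_le_exp m i) _.
  by rewrite leq_pmulr // bin_gt0 ltnW.
rewrite -mulr_sumr ler_wpM2l // exprD1n.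
rewrite -(big_mkord xpredT (fun i => (m%:R * t) ^+ i *+ 'C(N, i))).
(* Neither of [m] and [N] dominates the other, so both ranges are widened to a common one; surplus
   terms on the right are nonnegative. *)
rewrite (@big_nat_widen _ _ _ 0 m.+1 (m.+1 + N.+1)) ?leq_addr //.
rewrite (@big_nat_widen _ _ _ 0 N.+1 (m.+1 + N.+1)) ?leq_addl //.
rewrite big_mkcond [leRHS]big_mkcond; apply: ler_sum => i _ /=.
have p : 0 <= (m%:R * t) ^+ i *+ 'C(N, i).
  by rewrite mulrn_wge0 // exprn_ge0 // mulr_ge0.
by case: ifP => [/andP[iN _]|_]; case: ifP => //; lia.
Qed.

Lemma constant_sandwiching (R : realType) (n : nat) (f : cube n -> R) (B : R) :
  (forall x, - B <= f x <= B) -> 0 <= B -> has_sandwiching f (2 * B) B.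
Proof.
move=> fB B0; exists (fun=> - B), (fun=> B); split => //.
- by rewrite /expectU !expect_const; lra.
- by apply: le_trans (L1norm_const _ _) _; rewrite normrN ger0_norm.
- by apply: le_trans (L1norm_const _ _) _; rewrite ger0_norm.
Qed.

Lemma has_sandwiching_le (R : realType) (n : nat) (f : cube n -> R)
    (a a' v v' : R) :
  a <= a' -> v <= v' -> has_sandwiching f a v -> has_sandwiching f a' v'.
Proof.
move=> aa vv [fl [fu [h1 h2 h3 h4]]]; exists fl, fu.
by split; rewrite // (le_trans _ aa, le_trans _ vv) //.
Qed.

Lemma radius_sandwiching (R : realType) (n : nat) (f q e : cube n -> R) (a v : R) :
  (forall x, `|f x - q x| <= e x) -> 2 * expectU e <= a ->
  L1norm q + L1norm e <= v ->
  has_sandwiching f a v.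
Proof.
move=> fq ea Lv; exists (fun x => q x + -1 * e x), (fun x => q x + e x); split.
- by move=> x; have := fq x; rewrite ler_norml; lra.
- by move: ea; rewrite /expectU !expectD expectZ; lra.
- apply: le_trans (L1normD _ _) (le_trans _ Lv); rewrite lerD2l.
  by apply: le_trans (L1normZ _ _) _; rewrite normrN1 mul1r.
- exact: le_trans (L1normD _ _) Lv.
Qed.

(** The main case: the choice of [k] enters only through the three conclusions of
    [degree_estimates]. *)
Lemma sandwiching_small (R : realType) (n m : nat) (V : 'I_m -> {set 'I_n})
    (g : 'I_m -> cube n -> R) (sigma : 'I_m -> R) (s t delta B C : R) (k : nat)
    (c : nat -> R) :
  let P x := \sum_(0 <= i < m.+1) c i * elem_sym i (fun j => g j x) in
  (0 < m)%N -> (0 < k)%N ->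
  (forall i j : 'I_m, i != j -> [disjoint V i & V j]) ->
  (forall i : 'I_m, depends_only_on (V i) (g i)) ->
  (forall i : 'I_m, 0 < sigma i) ->
  (forall i : 'I_m, expectU (g i) = 0) ->
  (forall i : 'I_m, L1norm (g i) <= t) ->
  (forall i, expectU (fun x => g i x ^+ (2 * k))
       <= (2 * k)%:R ^+ (2 * k) * sigma i ^+ (2 * k)) ->
  s = \sum_(i < m) sigma i ^+ 2 ->
  0 < delta < 1 -> 4 ^+ k <= delta ^- 2 ->
  (128 * k%:R ^+ 3) ^+ k * s ^+ k <= delta ->
  (forall x, - B <= P x <= B) ->
  (forall i : nat, (1 <= i <= m)%N -> `|c i| <= C) ->
  has_sandwiching P (12 * (B + C) * delta)
    (5 * ((B + C) * (m%:R * t + 1) ^+ (2 * k) * delta ^- 3)).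
Proof.
move=> P m0 k0 dV gV s0 g0 gt mom sE /andP[d0 d1] k4 ks PB cC.
have C0 : 0 <= C by apply: le_trans (cC 1%N _).
have t0 : 0 <= t by apply: le_trans (gt (Ordinal m0)); apply: L1norm_ge0.
(* The coefficient [c 0] is the mean of [P], as all higher symmetric polynomials have mean zero, so
   it inherits the bound [B]. *)
have cB : `|c 0%N| <= B.
  have <- : expectU P = c 0%N.
    rewrite /expectU expect_sum big_nat_recl //= expectZ big1 => [|i _].
      rewrite addr0 (@eq_expect _ _ _ _ (fun=> 1)) ?expect_const ?mulr1 // => x.
      by rewrite elem_sym0.
    by rewrite expectZ -/(expectU _) (expectU_elem_sym _ dV gV g0) mulr0.
  rewrite ler_norml -{1}(expect_const (uniform R n) (- B)).
  rewrite -{2}(expect_const (uniform R n) B).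
  by rewrite !expect_le // => x; case/andP: (PB x).
have B0 : 0 <= B := le_trans (normr_ge0 _) cB.
have BC0 : 0 <= B + C by rewrite addr_ge0.
set T := (m%:R * t + 1) ^+ (2 * k).
have mt0 : 0 <= m%:R * t by rewrite mulr_ge0.
have T0 : 0 <= T by rewrite exprn_ge0 // addr_ge0.
pose Q x := \sum_(0 <= i < m.+1 | (i < 2 * k)%N) c i * elem_sym i (fun j => g j x).
pose p1 x := \sum_j g j x; pose p2 x := \sum_j g j x ^+ 2.
have s_ge0 : 0 <= s by rewrite sE sumr_ge0 // => i _; apply: sqr_ge0.
have Ep2 : expectU (fun x => p2 x ^+ k) <= (2 * k)%:R ^+ (2 * k) * s ^+ k.
  by rewrite sE; apply: sum_sq_moment_le.
have Ep2_ge0 : 0 <= expectU (fun x => p2 x ^+ k).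
  rewrite -(expect_const (uniform R n) 0); apply: expect_le => x.
  by rewrite exprn_ge0 // sumr_ge0 // => i _; apply: sqr_ge0.
have Ep1 : expectU (fun x => p1 x ^+ (2 * k))
    <= 2 * 4 ^+ k * (2 * k)%:R ^+ k * expectU (fun x => p2 x ^+ k).
  apply: le_trans (sum_moment_le k dV gV g0) _.
  rewrite ler_wpM2r // ler_wpM2l ?mulr_ge0 ?exprn_ge0 //.
  by rewrite -natrX ler_nat ffact_le_exp.
have e4 : 1 <= 4 ^+ k :> R by rewrite exprn_ege1 // ler1n.
have ek : 1 <= (2 * k)%:R ^+ k :> R by rewrite exprn_ege1 // ler1n muln_gt0.
apply: (@radius_sandwiching _ _ _ Q
  (fun x => 2 * (B + C) * 4 ^+ k * (p1 x ^+ (2 * k) + p2 x ^+ k))).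
- move=> x; apply: truncation_error_le => //.
  by rewrite ler_norml; apply: PB.
- rewrite /expectU expectZ expectD -!/(expectU _).
  set E1 := expectU _ in Ep1 *; set E2 := expectU _ in Ep1 Ep2 Ep2_ge0 *.
  have h : E1 + E2 <= 3 * (4 ^+ k * (2 * k)%:R ^+ k) * E2.
    have : 1 <= 4 ^+ k * (2 * k)%:R ^+ k :> R by rewrite mulr_ege1.
    by move: Ep1; rewrite -[2 * 4 ^+ k * _]mulrA; nra.
  have h' : 4 ^+ k * (E1 + E2) <= 3 * ((128 * k%:R ^+ 3) ^+ k * s ^+ k).
    have -> : 3 * ((128 * k%:R ^+ 3) ^+ k * s ^+ k)
      = 4 ^+ k * (3 * (4 ^+ k * (2 * k)%:R ^+ k) * ((2 * k)%:R ^+ (2 * k) * s ^+ k)).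
      (* One factor 4 comes from the truncation error, [4 * (2 * k)] from symmetrization and
         Khinchine, and [(2 * k) ^ 2] from the moment hypothesis. *)
      have -> : (128 * k%:R ^+ 3 : R) = 4 * 4 * (2 * k)%:R * (2 * k)%:R ^+ 2.
        by rewrite natrM; ring.
      by rewrite (exprM (2 * k)%:R) expr2 !exprMn; ring.
    rewrite ler_wpM2l ?exprn_ge0 //; apply: le_trans h _.
    by rewrite ler_wpM2l // !mulr_ge0 ?exprn_ge0.
  (* The error then has mean at most [6 (B + C) delta], and the gap of the sandwich is twice
     that. *)
  have h3 : 4 ^+ k * (E1 + E2) <= 3 * delta by lra.
  have := ler_wpM2l BC0 h3; lra.
have L1Q : L1norm Q <= (B + C) * T.
  apply: L1norm_truncation => // -[|i] im; first by lra.
  by apply: le_trans (cC i.+1 _) _; rewrite //; lra.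
have L1p1 : L1norm (fun x => p1 x ^+ (2 * k)) <= T.
  apply: le_trans (L1normX _ _) _.
  rewrite lerXn2r ?nnegrE ?L1norm_ge0 ?addr_ge0 //.
  apply: (@le_trans _ _ (m%:R * t)); last by lra.
  apply: le_trans (L1norm_sum _ _ _) _.
  rewrite mulr_natl -[X in _ *+ X]card_ord -sumr_const.
  exact: ler_sum.
have L1p2 : L1norm (fun x => p2 x ^+ k) <= T.
  apply: le_trans (L1normX _ _) _; rewrite /T exprM.
  rewrite lerXn2r ?nnegrE ?L1norm_ge0 ?exprn_ge0 ?addr_ge0 //.
  apply: (@le_trans _ _ (m%:R * t ^+ 2)).
    apply: le_trans (L1norm_sum _ _ _) _.
    rewrite mulr_natl -[X in _ *+ X]card_ord -sumr_const.
    apply: ler_sum => i _; apply: le_trans (L1normX _ _) _.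
    by rewrite lerXn2r ?nnegrE ?L1norm_ge0.
  have m1 : 1 <= m%:R :> R by rewrite ler1n.
  by have := sqr_ge0 t; nra.
set a := 2 * (B + C) * 4 ^+ k.
have a0 : 0 <= a by rewrite !mulr_ge0 ?exprn_ge0.
have L1e : L1norm (fun x => a * (p1 x ^+ (2 * k) + p2 x ^+ k)) <= a * (2 * T).
  apply: le_trans (L1normZ _ _) _; rewrite ger0_norm // ler_wpM2l //.
  apply: le_trans (L1normD _ _) _; lra.
have id1 : 1 <= delta^-1 by rewrite invf_ge1 // ltW.
have id2 : 1 <= delta ^- 2 by rewrite -exprVn exprn_ege1.
have id3 : delta ^- 2 <= delta ^- 3 by rewrite -!exprVn ler_weXn2l.
have BT0 : 0 <= (B + C) * T by rewrite mulr_ge0.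
apply: le_trans (lerD L1Q L1e) _.
(* The 1 accounts for [Q] and [4 * 4 ^+ k] for the error term; both 1 and [4 ^+ k] are at most
   [delta ^- 3]. *)
have h1 : 1 + 4 * 4 ^+ k <= 5 * delta ^- 3 by lra.
have := ler_wpM2l BT0 h1; rewrite /a; lra.
Qed.

Theorem theorem3p1 (R : realType) :
  exists K1 K2 K3 : R,
  forall (n m : nat) (V : 'I_m -> {set 'I_n}) (g : 'I_m -> cube n -> R)
    (sigma : 'I_m -> R) (sigma2 t delta eps B C : R) (k : nat)
    (c : nat -> R) (P : cube n -> R),
  (0 < m)%N ->
  (forall i j : 'I_m, i != j -> [disjoint V i & V j]) ->
  (forall i : 'I_m, depends_only_on (V i) (g i)) ->
  (forall i : 'I_m, 0 < sigma i) ->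
  (forall i : 'I_m, expectU (g i) = 0) ->
  (forall i : 'I_m, L1norm (g i) <= t) ->
  (forall (i : 'I_m) (r : nat), (1 <= r)%N ->
     expectU (fun x => g i x ^+ (2 * r))
       <= (2 * r)%:R ^+ (2 * r) * sigma i ^+ (2 * r)) ->
  sigma2 = (\sum_(i < m) sigma i ^+ 2) / m%:R ->
  0 < delta < 1 ->
  m%:R * sigma2 <= 1 / log2 (1 / delta) ^+ 25 ->
  k%:Z = Num.ceil (5 * log2 (1 / delta) / log2 (1 / (m%:R * sigma2))) ->
  eps = delta ^+ 4 / (m%:R * t + 1) ^+ (2 * k) ->
  (forall x, P x = \sum_(0 <= i < m.+1) c i * elem_sym i (fun j => g j x)) ->
  (forall x, - B <= P x <= B) ->
  (forall i : nat, (1 <= i <= m)%N -> `|c i| <= C) ->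
  (forall D : distr R n, biased eps D ->
     `|expectU P - expect D P| <= K1 * (B + C) * delta)
  /\
  has_sandwiching P (K2 * (B + C) * delta)
    (K3 * ((B + C) * (m%:R * t + 1) ^+ (2 * k) * delta ^- 3)).
Proof.
(* 12 and 5 are the sandwich constants. For part (1), [eps] times the norm bound is
   [5 (B + C) delta], whence 17 = 12 + 5. *)
exists 17, 12, 5 => n m V g sigma sigma2 t delta eps B C k c P m0 dV gV s0 g0 gt.
move=> mom sE d01 sL kE epsE PE PB cC; have /andP[d0 d1] := d01.
have C0 : 0 <= C by apply: le_trans (cC 1%N _).
have B0 : 0 <= B by have /andP[h1 h2] := PB [ffun=> false]; lra.
have t0 : 0 <= t by apply: le_trans (gt (Ordinal m0)); apply: L1norm_ge0.
have mt1 : 1 <= m%:R * t + 1 by rewrite lerDr mulr_ge0.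
set T := (m%:R * t + 1) ^+ (2 * k) in epsE *.
have T1 : 1 <= T by rewrite exprn_ege1.
have T0 : 0 < T by lra.
suff S : has_sandwiching P (12 * (B + C) * delta) (5 * ((B + C) * T * delta ^- 3)).
  split => // D bD; have eps0 : 0 <= eps.
    by rewrite epsE; apply: divr_ge0; [by rewrite exprn_ge0 // ltW | exact: ltW].
  apply: le_trans (sandwich_fools bD eps0 S) _.
  rewrite (_ : eps * _ = 5 * (B + C) * delta); last first.
    by rewrite epsE; field; rewrite !gt_eqF.
  lra.
(* For [delta > 1 / 4] the constant sandwich suffices, as [2 B <= 12 (B + C) delta]. *)
have [d4|d4] := leP delta (1 / 4); last first.
  apply: has_sandwiching_le (constant_sandwiching PB B0); first by nra.
  have id1 : 1 <= delta ^- 3 by rewrite -exprVn exprn_ege1 // invf_ge1 // ltW.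
  have : 1 <= T * delta ^- 3 by rewrite mulr_ege1.
  by rewrite -mulrA => h; nra.
have mn0 : m%:R != 0 :> R by rewrite pnatr_eq0 -lt0n.
have sE' : m%:R * sigma2 = \sum_(i < m) sigma i ^+ 2.
  by rewrite sE mulrCA mulfV // mulr1.
have spos : 0 < m%:R * sigma2.
  rewrite sE' (bigD1 (Ordinal m0)) //= ltr_wpDr ?exprn_gt0 //.
  by apply: sumr_ge0 => i _; apply: sqr_ge0.
have d04 : 0 < delta <= 1 / 4 by rewrite d0.
have [k0 k4 ks] := degree_estimates spos d04 sL kE.
have [fl [fu [h1 h2 h3 h4]]] := @sandwiching_small R n m V g sigma _ t delta B C k c
  m0 k0 dV gV s0 g0 gt (fun i => mom i k k0) sE' d01 k4 ks
  (fun x => eq_ind _ (fun y => is_true (- B <= y <= B)) (PB x) _ (PE x)) cC.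
by exists fl, fu; split => // x; rewrite PE.
Qed.
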